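(* Fix a state $\boldsymbol x\in[0,1]^{\mathcal E}$ and let $\mathcal A\in\mathcal B_B$ be a candidate base with certificate gap $\epsilon_{\mathcal A}$. Then $$g(\mathcal A)\ \le\ \max_{\mathcal C\in\mathcal B_B}g(\mathcal C)\ \le\ g(\mathcal A)+\epsilon_{\mathcal A}.$$ Define $\tau_{\mathcal A}=\dfrac{g(\mathcal A)}{g(\mathcal A)+\epsilon_{\mathcal A}}$ if $g(\mathcal A)+\epsilon_{\mathcal A}>0$, and $\tau_{\mathcal A}=1$ otherwise. Then $$g(\mathcal A)\ \ge\ \tau_{\mathcal A}\max_{\mathcal C\in\mathcal B_B}g(\mathcal C).$$
   Context: **Setting.** Let $R\ge1$. For $r=1,\dots,R$ let $\mathbf U_r\in\mathbb R^{N_r\times K_r}$ have full column rank, with $i$th row $(\boldsymbol u_i^{(r)})^\top$, $\mathcal N_r=\{1,\dots,N_r\}$, $N_\Sigma=\sum_rN_r$, $Z_r=\sum_{i,j\in\mathcal N_r}((\boldsymbol u_i^{(r)})^\top\boldsymbol u_j^{(r)})^2$. Ground set $\mathcal E=\bigcup_r(\{r\}\times\mathcal N_r)$; for $\mathcal C\subseteq\mathcal E$, $\mathcal C_r=\{i:(r,i)\in\mathcal C\}$. Integers $\kappa_r$ with $K_r\le\kappa_r\le N_r$ and $L$ with $\sum_r\kappa_r\le L\le N_\Sigma$ are given; $B=N_\Sigma-L$ and $\mathcal B_B=\{\mathcal C\subseteq\mathcal E:|\mathcal C|=B,\ |\mathcal C_r|\le N_r-\kappa_r\ \forall r\}$.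 **Gradient.** For $\boldsymbol x\in[0,1]^{\mathcal E}$ put $\boldsymbol y=\boldsymbol 1-\boldsymbol x$, $a_i^{(r)}=\|\boldsymbol u_i^{(r)}\|_2^4$, $b_i^{(r)}=\sum_{j\ne i}((\boldsymbol u_i^{(r)})^\top\boldsymbol u_j^{(r)})^2$, $H_r(\boldsymbol x)=\sum_ia_i^{(r)}y_i^{(r)}+\sum_{i\ne j}((\boldsymbol u_i^{(r)})^\top\boldsymbol u_j^{(r)})^2y_i^{(r)}y_j^{(r)}$, $\widetilde v(\boldsymbol x)=1-\prod_rH_r(\boldsymbol x)/Z_r$. For $e=(r,i)$, $g_e=\partial\widetilde v/\partial x_i^{(r)}(\boldsymbol x)$, and $g(\mathcal C)=\sum_{e\in\mathcal C}g_e$. **Gradient intervals at $\boldsymbol x$.** Put $\gamma_r=\frac1{Z_r}\prod_{s\ne r}\frac{H_s(\boldsymbol x)}{Z_s}$, $\bar y_r=\frac1{N_r}\sum_iy_i^{(r)}$, $\Delta_r=\max_i|y_i^{(r)}-\bar y_r|$, $d_i^{(r)}=\|\boldsymbol u_i^{(r)}\|_2^2$, $\mathbf M_r=\mathbf U_r^\top\operatorname{diag}(\boldsymbol y^{(r)})\mathbf U_r-\bar y_r\mathbf U_r^\top\mathbf U_r$, $\mu_r=\operatorname{tr}(\mathbf M_r)/K_r$, $\mathbf R_r=\mathbf M_r-\mu_r\mathbf I_{K_r}$. For $e=(r,i)$: $q_e^{\rm mean}=\gamma_r(a_i^{(r)}+2b_i^{(r)}\bar y_r)$, $\rho_e^{\rm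 mean}=2\gamma_rb_i^{(r)}\Delta_r$, $\widehat q_e=\gamma_r[a_i^{(r)}+2b_i^{(r)}\bar y_r+2\mu_rd_i^{(r)}-2a_i^{(r)}(y_i^{(r)}-\bar y_r)]$, $\rho_e=2\gamma_r\|\mathbf R_r\|_2d_i^{(r)}$ (spectral norm). The lower and upper bounds are $\ell_e=\max\{0,q_e^{\rm mean}-\rho_e^{\rm mean},\widehat q_e-\rho_e\}$ and $u_e=\min\{q_e^{\rm mean}+\rho_e^{\rm mean},\widehat q_e+\rho_e\}$, except that for each $e$ in some (arbitrary, possibly empty) set of exactly queried coordinates one sets $\ell_e=u_e=g_e$. **Certificate gap.** For $\mathcal A\in\mathcal B_B$ let $z_e(\mathcal A)=\ell_e$ if $e\in\mathcal A$, $z_e(\mathcal A)=u_e$ if $e\notin\mathcal A$, and $\epsilon_{\mathcal A}=\max_{\mathcal C\in\mathcal B_B}\sum_{e\in\mathcal C}z_e(\mathcal A)-\sum_{e\in\mathcal A}\ell_e$. *)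

(* Defs.v *)
(* MathComp and MathComp-Analysis; the reals are an arbitrary [R : realType]. *)
From mathcomp Require Import all_boot all_order all_algebra.
From mathcomp Require Import all_classical all_reals all_analysis.

Set Implicit Arguments.
Unset Strict Implicit.
Unset Printing Implicit Defensive.

Import Order.TTheory GRing.Theory Num.Theory.
Import numFieldNormedType.Exports.

Local Open Scope classical_set_scope.
Local Open Scope ring_scope.

Section Norms.
Variable R : realType.

Definition dotv (n : nat) (u v : 'cV[R]_n) : R := (u^T *m v) 0 0.

(* The norm MathComp-Analysis puts on matrices is the max norm, hence these
   Euclidean and operator norms. *)
Definition norm2 (n : nat) (u : 'cV[R]_n) : R := Num.sqrt (dotv u u).

Definition spectral_norm (m n : nat) (A : 'M[R]_(m, n)) : R :=
  sup [set norm2 (A *m v) | v in [set v : 'cV[R]_n | norm2 v <= 1]].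

(* This is the maximum of [F] over [P] whenever [c0 \in P]; the value [F c0]
   only seeds the iterated binary maximum. *)
Definition max_over (T : finType) (P : {set T}) (c0 : T) (F : T -> R) : R :=
  \big[Num.max/F c0]_(c in P) F c.

End Norms.

Definition ground (nb : nat) (N : 'I_nb -> nat) : finType :=
  {r : 'I_nb & 'I_(N r)}.

Definition elt (nb : nat) (N : 'I_nb -> nat) (r : 'I_nb) (i : 'I_(N r)) :
  ground N := Tagged (fun r => 'I_(N r)) i.

Definition block (nb : nat) (N : 'I_nb -> nat) (C : {set ground N})
    (r : 'I_nb) : {set 'I_(N r)} :=
  [set i : 'I_(N r) | elt i \in C]%SET.

Definition bases (nb : nat) (N kappa : 'I_nb -> nat) (L : nat) :
    {set {set ground N}} :=
  [set C : {set ground N} |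
     (#|C| == (\sum_(r < nb) N r) - L)%N &&
     [forall r : 'I_nb, (#|block C r| <= N r - kappa r)%N]]%SET.

Section Gradient.
Variables (R : realType) (nb : nat) (N K : 'I_nb -> nat).
Variable U : forall r : 'I_nb, 'M[R]_(N r, K r).

Definition uvec (r : 'I_nb) (i : 'I_(N r)) : 'cV[R]_(K r) := (row i (U r))^T.

Definition gram2 (r : 'I_nb) (i j : 'I_(N r)) : R :=
  dotv (uvec i) (uvec j) ^+ 2.

Definition Zc (r : 'I_nb) : R :=
  \sum_(i < N r) \sum_(j < N r) gram2 i j.

Definition acoef (r : 'I_nb) (i : 'I_(N r)) : R := norm2 (uvec i) ^+ 4.

Definition bcoef (r : 'I_nb) (i : 'I_(N r)) : R :=
  \sum_(j < N r | j != i) gram2 i j.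

Definition dcoef (r : 'I_nb) (i : 'I_(N r)) : R := norm2 (uvec i) ^+ 2.

Section State.
Variable x : ground N -> R.

Definition yv (r : 'I_nb) (i : 'I_(N r)) : R := 1 - x (elt i).

(* The second sum is over ordered pairs [i != j], so that [H r = Zc r] at
   [x = 0]. *)
Definition H (r : 'I_nb) : R :=
  \sum_(i < N r) acoef i * yv i
  + \sum_(i < N r) \sum_(j < N r | j != i) gram2 i j * yv i * yv j.

Definition vtilde : R := 1 - \prod_(r < nb) (H r / Zc r).

End State.

Section StateIntervals.
Variable x : ground N -> R.

(* [vtilde] is a polynomial defined on all of R^E, so the partial derivative
   is two-sided also at boundary points of the cube. *)
Definition grad (e : ground N) : R :=
  derive1 (fun t : R => vtilde [eta x with e |-> t]) (x e).

Definition gradset (C : {set ground N}) : R := \sum_(e in C) grad e.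

Definition gammac (r : 'I_nb) : R :=
  (Zc r)^-1 * \prod_(s < nb | s != r) (H x s / Zc s).

Definition ybar (r : 'I_nb) : R := (\sum_(i < N r) yv x i) / (N r)%:R.

Definition Delta (r : 'I_nb) : R :=
  \big[Num.max/0]_(i < N r) `|yv x i - ybar r|.

Definition Mmat (r : 'I_nb) : 'M[R]_(K r) :=
  (U r)^T *m diag_mx (\row_(i < N r) yv x i) *m U r
  - ybar r *: ((U r)^T *m U r).

Definition muc (r : 'I_nb) : R := \tr (Mmat r) / (K r)%:R.

Definition Rmat (r : 'I_nb) : 'M[R]_(K r) := Mmat r - (muc r)%:M.

Definition q_mean (r : 'I_nb) (i : 'I_(N r)) : R :=
  gammac r * (acoef i + 2 * bcoef i * ybar r).

Definition rho_mean (r : 'I_nb) (i : 'I_(N r)) : R :=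
  2 * gammac r * bcoef i * Delta r.

Definition q_hat (r : 'I_nb) (i : 'I_(N r)) : R :=
  gammac r * (acoef i + 2 * bcoef i * ybar r + 2 * muc r * dcoef i
              - 2 * acoef i * (yv x i - ybar r)).

Definition rho_hat (r : 'I_nb) (i : 'I_(N r)) : R :=
  2 * gammac r * spectral_norm (Rmat r) * dcoef i.

(* [Q] is the set of exactly queried coordinates. *)
Variable Q : {set ground N}.

Definition lower (e : ground N) : R :=
  let i := tagged e in
  if e \in Q then grad e
  else Num.max 0 (Num.max (q_mean i - rho_mean i) (q_hat i - rho_hat i)).

Definition upper (e : ground N) : R :=
  let i := tagged e in
  if e \in Q then grad e
  else Num.min (q_mean i + rho_mean i) (q_hat i + rho_hat i).

Variables (kappa : 'I_nb -> nat) (L : nat).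
Variable A : {set ground N}.

Definition zval (e : ground N) : R := if e \in A then lower e else upper e.

Definition gap : R :=
  max_over (bases N kappa L) A (fun C => \sum_(e in C) zval e)
  - \sum_(e in A) lower e.

Definition max_grad : R := max_over (bases N kappa L) A gradset.

Definition tau : R :=
  if 0 < gradset A + gap then gradset A / (gradset A + gap) else 1.

End StateIntervals.
End Gradient.

(* Main.v *)
(* [vtilde] is affine in each coordinate, so [grad] at [(r, i)] is
   [gammac r * (a_i + 2 * \sum_(j != i) gram2 i j * y_j)].  Replacing [y_j] by
   [ybar r] there gives [q_mean], with error bounded by [Delta r].  The same
   error is also [u_i^T M u_i] up to its diagonal term [j = i]; writing
   [M = mu I + R] gives [q_hat], and Cauchy-Schwarz with the operator norm bounds
   [u_i^T R u_i].  Hence [lower <= grad <= upper].  For two bases [A] and [C],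
   the common part cancels in [g(C) - g(A)], so bounding [g] by [upper] on
   [C \ A] and by [lower] on [A \ C] bounds the difference by the gap. *)
Require Import Defs.
From mathcomp Require Import all_boot all_order all_algebra.
From mathcomp Require Import all_classical all_reals all_analysis.
From mathcomp Require Import ring lra.
Import Order.TTheory GRing.Theory Num.Theory.
Import numFieldNormedType.Exports.
Local Open Scope ring_scope.

Set Implicit Arguments.
Unset Strict Implicit.
Unset Printing Implicit Defensive.

(** * Euclidean norm, Cauchy-Schwarz and the operator norm *)

Section EuclideanNorm.
Variable R : realType.

Lemma dotvE n (u v : 'cV[R]_n) : dotv u v = \sum_i u i 0 * v i 0.
Proof. by rewrite /dotv mxE; apply: eq_bigr => i _; rewrite mxE. Qed.

Lemma dotvC n (u v : 'cV[R]_n) : dotv u v = dotv v u.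
Proof. by rewrite !dotvE; apply: eq_bigr => i _; rewrite mulrC. Qed.

Lemma dotv_combl n a b (u v w : 'cV[R]_n) :
  dotv (a *: u - b *: v) w = a * dotv u w - b * dotv v w.
Proof.
rewrite !dotvE !mulr_sumr -sumrB; apply: eq_bigr => i _.
by rewrite !mxE; ring.
Qed.

Lemma dotvv_ge0 n (u : 'cV[R]_n) : 0 <= dotv u u.
Proof. by rewrite dotvE; apply: sumr_ge0 => i _; rewrite -expr2 sqr_ge0. Qed.

Lemma norm2_ge0 n (u : 'cV[R]_n) : 0 <= norm2 u.
Proof. exact: sqrtr_ge0. Qed.

Lemma sqr_norm2 n (u : 'cV[R]_n) : norm2 u ^+ 2 = dotv u u.
Proof. by rewrite sqr_sqrtr // dotvv_ge0. Qed.

Lemma norm2_eq0 n (u : 'cV[R]_n) : norm2 u = 0 -> u = 0.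
Proof.
move=> u0; have: dotv u u = 0 by rewrite -sqr_norm2 u0 expr0n.
rewrite dotvE => /eqP; rewrite psumr_eq0 => [/allP s0|i _]; last first.
  by rewrite -expr2 sqr_ge0.
apply/colP => i; rewrite mxE; apply/eqP.
by have := s0 i (mem_index_enum _); rewrite mulf_eq0 orbb.
Qed.

Lemma norm2Z n c (u : 'cV[R]_n) : norm2 (c *: u) = `|c| * norm2 u.
Proof.
rewrite /norm2 /dotv -scalemxAr linearZ/= -scalemxAl !mxE mulrA -expr2.
by rewrite sqrtrM ?sqr_ge0// sqrtr_sqr.
Qed.

Lemma cauchy_schwarz n (u v : 'cV[R]_n) : `|dotv u v| <= norm2 u * norm2 v.
Proof.
have [/norm2_eq0 ->|v0] := eqVneq (norm2 v) 0.
  by rewrite /dotv mulmx0 mxE normr0 mulr_ge0 ?norm2_ge0.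
have s0 : 0 < dotv v v by rewrite -sqr_norm2 exprn_gt0// lt0r v0 norm2_ge0.
rewrite -ler_sqr ?nnegrE ?mulr_ge0 ?norm2_ge0// real_normK ?num_real//.
rewrite exprMn !sqr_norm2.
(* This vector is [dotv v v] times the component of [u] orthogonal to [v]; its squared norm is
   [dotv v v] times the Cauchy-Schwarz defect. *)
have := dotvv_ge0 (dotv v v *: u - dotv u v *: v).
have -> : dotv (dotv v v *: u - dotv u v *: v) (dotv v v *: u - dotv u v *: v) =
    dotv v v * (dotv u u * dotv v v - dotv u v ^+ 2).
  by rewrite dotv_combl (dotvC u) (dotvC v) !dotv_combl (dotvC v u); ring.
by rewrite pmulr_rge0// subr_ge0.
Qed.

(** Nonemptiness and boundedness are what make the [sup] in [spectral_norm] an actual upper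
    bound. *)
Lemma has_sup_spectral_norm m n (A : 'M[R]_(m, n)) :
  has_sup [set norm2 (A *m v) | v in [set v : 'cV[R]_n | norm2 v <= 1]]%classic.
Proof.
split.
  exists (norm2 (A *m 0)), 0 => //=.
  by rewrite /norm2 /dotv mulmx0 mxE sqrtr0 ler01.
(* The Frobenius norm serves as a bound, by Cauchy-Schwarz on each row. *)
exists (Num.sqrt (\sum_i norm2 (row i A)^T ^+ 2)) => _ [v /= v1 <-].
rewrite ler_wsqrtr// dotvE ler_sum// => i _.
rewrite -expr2; have -> : (A *m v) i 0 = dotv (row i A)^T v.
  by rewrite /dotv trmxK -row_mul [RHS]mxE.
rewrite -real_normK ?num_real// ler_sqr ?nnegrE ?norm2_ge0//.
by rewrite (le_trans (cauchy_schwarz _ _))// ler_piMr ?norm2_ge0.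
Qed.

Lemma norm2_mulmx_le m n (A : 'M[R]_(m, n)) (v : 'cV[R]_n) :
  norm2 (A *m v) <= spectral_norm A * norm2 v.
Proof.
have [/norm2_eq0 ->|v0] := eqVneq (norm2 v) 0.
  by rewrite /norm2 /dotv !mulmx0 !mxE sqrtr0 mulr0.
have v_gt0 : 0 < norm2 v by rewrite lt0r v0 norm2_ge0.
rewrite -ler_pdivrMr//; apply: sup_upper_bound.
  exact: has_sup_spectral_norm.
(* By homogeneity it suffices to evaluate at the normalized vector. *)
exists ((norm2 v)^-1 *: v) => /=; last first.
  by rewrite -scalemxAr norm2Z ger0_norm ?invr_ge0 ?norm2_ge0// mulrC.
by rewrite norm2Z ger0_norm ?invr_ge0 ?norm2_ge0// mulVf.
Qed.

Lemma quad_form_le n (A : 'M[R]_n) (v : 'cV[R]_n) :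
  `|dotv v (A *m v)| <= spectral_norm A * norm2 v ^+ 2.
Proof.
rewrite (le_trans (cauchy_schwarz _ _))//.
by rewrite mulrC expr2 mulrA ler_wpM2r ?norm2_ge0 ?norm2_mulmx_le.
Qed.

End EuclideanNorm.

(** * Bounds for a seeded maximum *)

Section MaxOver.
Variables (R : realType) (T : finType).
Implicit Types (P : {set T}) (c : T) (F : T -> R).

Lemma le_max_over P c0 F c : c \in P -> F c <= max_over P c0 F.
Proof. by move=> cP; exact: le_bigmax_cond. Qed.

Lemma max_over_le P c0 F b : F c0 <= b -> (forall c, c \in P -> F c <= b) ->
  max_over P c0 F <= b.
Proof. by move=> F0 Fb; apply/bigmax_leP; split. Qed.

End MaxOver.

(** * Exchange bound for weights known only up to intervals *)

Section IntervalCertificate.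
Variables (R : realType) (T : finType) (A : {set T}) (l g u : T -> R).
Hypothesis lg : forall e, l e <= g e.
Hypothesis gu : forall e, g e <= u e.

Lemma exchange_gap_le (C : {set T}) :
  \sum_(e in C) g e - \sum_(e in A) g e <=
  \sum_(e in C) (if e \in A then l e else u e) - \sum_(e in A) l e.
Proof.
rewrite lerBlDr addrAC -addrA -lerBlDl -!sumrB.
(* With [z] the conditional weight, the goal now compares [g - z] summed over [C] with [g - l]
   summed over [A]. The two agree on the intersection; the rest is nonpositive on [C :\: A] and
   nonnegative on [A :\: C]. *)
rewrite (bigID (mem A))/=.
have -> : \sum_(e in A) (g e - l e) = \sum_(e in A :&: C) (g e - l e) +
   \sum_(e in A :\: C) (g e - l e) by rewrite -big_setID.
apply: lerD.
  rewrite le_eqVlt; apply/orP; left; apply/eqP; apply: eq_big => [e|e].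
    by rewrite inE andbC.
  by case/andP => _ ->.
rewrite (le_trans (y := 0))//.
  by apply: sumr_le0 => e /andP[_ /negbTE ->]; rewrite subr_le0.
by apply: sumr_ge0 => e _; rewrite subr_ge0.
Qed.

End IntervalCertificate.

(** * Closed form of the partial derivatives *)

Section Gradient.
Variables (R : realType) (nb : nat) (N K : 'I_nb -> nat).
Variable U : forall r : 'I_nb, 'M[R]_(N r, K r).
Implicit Types x : ground N -> R.

Lemma gram2C r (i j : 'I_(N r)) : gram2 U i j = gram2 U j i.
Proof. by rewrite /gram2 dotvC. Qed.

Lemma gram2_ge0 r (i j : 'I_(N r)) : 0 <= gram2 U i j.
Proof. exact: sqr_ge0. Qed.

Lemma gram2_diag r (i : 'I_(N r)) : gram2 U i i = acoef U i.
Proof. by rewrite /gram2 /acoef -sqr_norm2 -exprM. Qed.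

Lemma acoef_ge0 r (i : 'I_(N r)) : 0 <= acoef U i.
Proof. by rewrite -gram2_diag gram2_ge0. Qed.

Lemma Zc_ge0 r : 0 <= Zc U r.
Proof. by apply: sumr_ge0 => i _; apply: sumr_ge0 => j _; exact: gram2_ge0. Qed.

(** The part of [H] on block [r] that is free of [y_i]. *)
Definition rest_of_H x r (i : 'I_(N r)) : R :=
  \sum_(k < N r | k != i) acoef U k * yv x k +
  \sum_(k < N r | k != i) \sum_(j < N r | (j != k) && (j != i))
     gram2 U k j * yv x k * yv x j.

(** The coefficient of [y_i] in [H]; the factor 2 accounts for the ordered pairs [(i, j)] and
    [(j, i)]. *)
Definition slope x r (i : 'I_(N r)) : R :=
  acoef U i + 2 * \sum_(j < N r | j != i) gram2 U i j * yv x j.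

Lemma H_split x r (i : 'I_(N r)) :
  H U x r = rest_of_H x i + yv x i * slope x i.
Proof.
rewrite /H /rest_of_H /slope (bigD1 i)//= [X in _ + X = _](bigD1 i)//=.
(* Every other row [k] gives up its term in column [i], which contains [y_i]. *)
under [X in _ + (_ + X) = _]eq_bigr => k ki do
  rewrite (bigD1 i) 1?eq_sym//=.
rewrite big_split/=.
have -> : \sum_(j < N r | j != i) gram2 U i j * yv x i * yv x j =
    yv x i * \sum_(j < N r | j != i) gram2 U i j * yv x j.
  by rewrite mulr_sumr; apply: eq_bigr => j _; ring.
have -> : \sum_(j < N r | j != i) gram2 U j i * yv x j * yv x i =
    yv x i * \sum_(j < N r | j != i) gram2 U i j * yv x j.
  by rewrite mulr_sumr; apply: eq_bigr => j _; rewrite (gram2C j); ring.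
ring.
Qed.

Lemma yv_update_other x r s (i : 'I_(N r)) (j : 'I_(N s)) t :
  elt j != elt i -> yv [eta x with elt i |-> t] j = yv x j.
Proof. by rewrite /yv /= => /negbTE ->. Qed.

Lemma yv_update_block x r s (i : 'I_(N r)) (j : 'I_(N s)) t :
  s != r -> yv [eta x with elt i |-> t] j = yv x j.
Proof.
move=> sr; apply: yv_update_other; apply: contra sr => /eqP ji.
exact/eqP/(congr1 tag ji).
Qed.

Lemma H_update_block x r s (i : 'I_(N r)) t :
  s != r -> H U [eta x with elt i |-> t] s = H U x s.
Proof.
move=> sr; rewrite /H; congr (_ + _).
  by apply: eq_bigr => j _; rewrite yv_update_block.
by apply: eq_bigr => j _; apply: eq_bigr => k _; rewrite !yv_update_block.
Qed.

(** Neither [rest_of_H] nor [slope] involves [y_i], so both survive the update. *)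
Lemma H_update x r (i : 'I_(N r)) t :
  H U [eta x with elt i |-> t] r = rest_of_H x i + (1 - t) * slope x i.
Proof.
have yE j : j != i -> yv [eta x with elt i |-> t] j = yv x j.
  by move=> ji; rewrite yv_update_other// eq_Tagged.
rewrite (H_split _ i); congr (_ + _ * _).
- rewrite /rest_of_H; congr (_ + _).
    by apply: eq_bigr => k ki; rewrite yE.
  by apply: eq_bigr => k ki; apply: eq_bigr => j /andP[_ ji]; rewrite !yE.
- by rewrite /yv /= eqxx.
- by rewrite /slope; congr (_ + _ * _); apply: eq_bigr => j ji; rewrite yE.
Qed.

Lemma gradE x r (i : 'I_(N r)) : grad U x (elt i) = gammac U x r * slope x i.
Proof.
rewrite /grad; set P := \prod_(s < nb | s != r) (H U x s / Zc U s).
have -> : (fun t => vtilde U [eta x with elt i |-> t]) =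
    (fun t : R => 1 - (rest_of_H x i + (1 - t) * slope x i) / Zc U r * P).
  apply/funext => t; rewrite /vtilde (bigD1 r)//= H_update.
  congr (_ - _ * _); apply: eq_bigr => s sr.
  by rewrite H_update_block.
(* Constant plus linear part in [t]: the minus sign of [1 - t] cancels the one before the product,
   so the linear coefficient is positive in [slope]. *)
have -> : (fun t : R => 1 - (rest_of_H x i + (1 - t) * slope x i) / Zc U r * P) =
    cst (1 - (rest_of_H x i + slope x i) / Zc U r * P) \+
      (gammac U x r * slope x i) \*: (@idfun R).
  by apply/funext => t /=; rewrite /gammac -/P /GRing.scale/=; ring.
rewrite derive1E deriveD//= derive_cst deriveZ// derive_id add0r.
by rewrite /GRing.scale/= mulr1.
Qed.

(** * Validity of the gradient intervals on the cube *)

Section Cube.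
Variable x : ground N -> R.
Hypothesis x_cube : forall e, 0 <= x e <= 1.

Lemma yv_ge0 r (i : 'I_(N r)) : 0 <= yv x i.
Proof. by rewrite subr_ge0; have /andP[] := x_cube (elt i). Qed.

Lemma H_ge0 r : 0 <= H U x r.
Proof.
apply: addr_ge0.
  by apply: sumr_ge0 => i _; rewrite mulr_ge0 ?acoef_ge0 ?yv_ge0.
apply: sumr_ge0 => i _; apply: sumr_ge0 => j _.
by rewrite mulr_ge0 ?yv_ge0 // mulr_ge0 ?gram2_ge0 ?yv_ge0.
Qed.

Lemma gammac_ge0 r : 0 <= gammac U x r.
Proof.
rewrite mulr_ge0 ?invr_ge0 ?Zc_ge0//.
by apply: prodr_ge0 => s _; rewrite divr_ge0 ?H_ge0 ?Zc_ge0.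
Qed.

(** This justifies the clamp at 0 in [lower], and later the sign of [gradset]. *)
Lemma grad_ge0 e : 0 <= grad U x e.
Proof.
case: e => r i; rewrite gradE mulr_ge0 ?gammac_ge0// addr_ge0 ?acoef_ge0//.
by rewrite mulr_ge0// sumr_ge0// => j _; rewrite mulr_ge0 ?gram2_ge0 ?yv_ge0.
Qed.

(** Half the error in [slope] when each [y_j] is replaced by the block mean. The two intervals are
    two ways of estimating it. *)
Definition deviation r (i : 'I_(N r)) : R :=
  \sum_(j < N r | j != i) gram2 U i j * (yv x j - ybar x r).

Lemma slope_deviation r (i : 'I_(N r)) :
  slope x i = acoef U i + 2 * bcoef U i * ybar x r + 2 * deviation i.
Proof.
rewrite /slope /deviation.
under [X in _ = _ + 2 * X]eq_bigr do rewrite mulrBr.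
by rewrite sumrB -mulr_suml -/(bcoef U i); ring.
Qed.

Lemma grad_mean r (i : 'I_(N r)) :
  `|grad U x (elt i) - q_mean U x i| <= rho_mean U x i.
Proof.
rewrite gradE slope_deviation /q_mean /rho_mean -mulrBr addrC addrA addNr add0r.
rewrite normrM ger0_norm ?gammac_ge0// normrM normr_nat.
rewrite [leRHS](_ : _ = gammac U x r * (2 * (bcoef U i * Delta x r))); last ring.
rewrite ler_wpM2l ?gammac_ge0// ler_wpM2l// (le_trans (ler_norm_sum _ _ _))//.
rewrite mulr_suml ler_sum// => j _.
rewrite normrM ger0_norm ?gram2_ge0// ler_wpM2l ?gram2_ge0//.
exact: (le_bigmax _ (fun k => `|yv x k - ybar x r|) j).
Qed.

(** Since [M = U^T diag(y - ybar) U], the form is the sum over all [j] of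
    [gram2 i j * (y_j - ybar)]; the term [j = i] carries [acoef]. *)
Lemma quad_form_Mmat r (i : 'I_(N r)) :
  dotv (uvec U i) (Mmat U x r *m uvec U i) =
  acoef U i * (yv x i - ybar x r) + deviation i.
Proof.
rewrite -gram2_diag /deviation.
rewrite -(bigD1 (P := predT) i
  (F := fun j => gram2 U i j * (yv x j - ybar x r)))//=.
have Uu j : (U r *m uvec U i) j 0 = dotv (uvec U i) (uvec U j).
  by rewrite dotvC /dotv trmxK -row_mul [RHS]mxE.
have -> : dotv (uvec U i) (Mmat U x r *m uvec U i) =
    dotv (U r *m uvec U i)
         (diag_mx (\row_j (yv x j - ybar x r)) *m (U r *m uvec U i)).
  rewrite /dotv trmx_mul.
  have -> : Mmat U x r = (U r)^T *m diag_mx (\row_j (yv x j - ybar x r)) *m U r.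
    (* The constant row becomes a scalar matrix, which yields the subtracted multiple of [U^T U]. *)
    have -> : (\row_j (yv x j - ybar x r)) =
        (\row_j yv x j) - const_mx (ybar x r) :> 'rV_(N r).
      by apply/rowP => j; rewrite !mxE.
    rewrite linearB/= diag_const_mx mulmxBr mulmxBl.
    by rewrite mul_mx_scalar -scalemxAl.
  by rewrite !mulmxA.
rewrite dotvE; apply: eq_bigr => j _.
by rewrite mul_diag_mx Uu [X in _ * X]mxE Uu [X in _ * (X * _)]mxE /gram2; ring.
Qed.

Lemma grad_hat r (i : 'I_(N r)) :
  `|grad U x (elt i) - q_hat U x i| <= rho_hat U x i.
Proof.
have M_split : dotv (uvec U i) (Mmat U x r *m uvec U i) =
    muc U x r * dcoef U i + dotv (uvec U i) (Rmat U x r *m uvec U i).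
  rewrite /Rmat /dcoef sqr_norm2; move: (muc U x r) (Mmat U x r) => m M.
  rewrite /dotv mulmxBl mul_scalar_mx mulmxBr -scalemxAr.
  move: (_ *m (M *m _)) => P; move: (_ *m uvec U i) => Q.
  by rewrite !mxE; ring.
(* The first and last terms are the corrections in [q_hat]; the middle one is the error bounded by
   [rho_hat]. *)
have devE : deviation i = muc U x r * dcoef U i +
    dotv (uvec U i) (Rmat U x r *m uvec U i) - acoef U i * (yv x i - ybar x r).
  by rewrite -M_split quad_form_Mmat addrAC subrr add0r.
rewrite gradE slope_deviation devE /q_hat /rho_hat.
rewrite [X in `|X|](_ : _ =
    gammac U x r * (2 * dotv (uvec U i) (Rmat U x r *m uvec U i))); last ring.
rewrite normrM ger0_norm ?gammac_ge0// normrM normr_nat.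
rewrite [leRHS](_ : _ =
  gammac U x r * (2 * (spectral_norm (Rmat U x r) * dcoef U i))); last ring.
by rewrite ler_wpM2l ?gammac_ge0// ler_wpM2l// quad_form_le.
Qed.

Lemma lower_le_grad Q e : lower U x Q e <= grad U x e.
Proof.
rewrite /lower; case: ifP => // _; case: e => r i.
have := grad_mean i; have := grad_hat i; rewrite !ler_norml => /andP[h _] /andP[m _].
rewrite !ge_max grad_ge0/=; apply/andP; split; rewrite -/(elt i)/=; lra.
Qed.

Lemma grad_le_upper Q e : grad U x e <= upper U x Q e.
Proof.
rewrite /upper; case: ifP => // _; case: e => r i.
have := grad_mean i; have := grad_hat i; rewrite !ler_norml => /andP[_ h] /andP[_ m].
rewrite le_min; apply/andP; split; rewrite -/(elt i)/=; lra.
Qed.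

End Cube.
End Gradient.

(** * The certificate for the candidate base *)

Theorem lemma5 (R : realType) (nb : nat) (N K kappa : 'I_nb -> nat) (L : nat)
    (U : forall r : 'I_nb, 'M[R]_(N r, K r))
    (x : ground N -> R) (Q A : {set ground N})
    (nb_ge1 : (1 <= nb)%N)
    (K_ge1 : forall r : 'I_nb, (1 <= K r)%N)
    (U_full_rank : forall r : 'I_nb, \rank (U r) = K r)
    (kappa_bounds : forall r : 'I_nb, (K r <= kappa r <= N r)%N)
    (L_bounds : (\sum_(r < nb) kappa r <= L <= \sum_(r < nb) N r)%N)
    (x_cube : forall e : ground N, 0 <= x e <= 1)
    (A_base : A \in bases N kappa L) :
  [/\ gradset U x A <= max_grad U x kappa L A,
      max_grad U x kappa L A <= gradset U x A + gap U x Q kappa L A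
    & tau U x Q kappa L A * max_grad U x kappa L A <= gradset U x A].
Proof.
have gA0 : 0 <= gradset U x A by apply: sumr_ge0 => e _; exact: grad_ge0.
have upper_bound :
    max_grad U x kappa L A <= gradset U x A + gap U x Q kappa L A.
  have bound C : C \in bases N kappa L ->
      gradset U x C <= gradset U x A + gap U x Q kappa L A.
    move=> CB; rewrite -lerBlDl.
    apply: (le_trans (exchange_gap_le A (lower_le_grad U x_cube Q)
      (grad_le_upper U x_cube Q) C)).
    rewrite lerD2r.
    exact: (le_max_over A (fun C => \sum_(e in C) zval U x Q A e) CB).
  (* The seed of the maximum is the value at [A], itself a base, so [bound] covers it too. *)
  by apply: max_over_le => //; exact: bound.
split => //; first exact: le_max_over.
(* If the denominator is nonpositive, the maximum is at most 0, hence at most [gradset U x A]. *)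
rewrite /tau; case: ltP => [pos|nonpos]; last first.
  by rewrite mul1r (le_trans upper_bound)// (le_trans nonpos).
(* Clearing the positive denominator leaves [upper_bound] multiplied by the nonnegative
   [gradset U x A]. *)
by rewrite mulrAC ler_pdivrMr// ler_wpM2l.
Qed.
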